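(* Let $\beta$ be a non-zero real number. For each integer $r\ge2$ let $\lambda_j=j(r-j)$ for $j=1,\dots,r-1$ and $$S_{r,\beta}=-\sum_{j=1}^{r-1}\hat p_{j,\beta}\log\hat p_{j,\beta},\qquad \hat p_{j,\beta}=\frac{\lambda_j^\beta}{\sum_{k=1}^{r-1}\lambda_k^\beta}.$$ Then $$\lim_{r\to\infty}(S_{r,\beta}-\log r)=\begin{cases}-\dfrac{2\beta d_\beta}{c_\beta}+\log(c_\beta) & \text{if }\beta>-1,\\[2mm] -\infty & \text{if }\beta\le-1,\end{cases}$$ where $$c_\beta=\int_0^1 s^\beta(1-s)^\beta\,ds,\qquad d_\beta=\int_0^1 s^\beta(1-s)^\beta\log s\,ds.$$
   Context: $\log$ is the natural logarithm. All objects are defined in the claim; $\lambda_j$ and $\hat p_{j,\beta}$ depend on $r$. *)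

(* Defs.v *)
From mathcomp Require Import all_boot all_order all_algebra.
From mathcomp Require Import all_classical all_reals all_analysis.

Set Implicit Arguments.
Unset Strict Implicit.
Unset Printing Implicit Defensive.

Import Order.TTheory GRing.Theory Num.Theory.
Import numFieldNormedType.Exports.

Local Open Scope classical_set_scope.
Local Open Scope ring_scope.

(* The subtraction is taken in [R], not in [nat]. *)
Definition lambda (R : realType) (r j : nat) : R := j%:R * (r%:R - j%:R).

Definition phat (R : realType) (beta : R) (r j : nat) : R :=
  lambda R r j `^ beta / \sum_(1 <= k < r) lambda R r k `^ beta.

(* Meaningful for [2 <= r]; for [r < 2] the sum is empty and the value is 0. *)
Definition entropy (R : realType) (beta : R) (r : nat) : R :=
  - \sum_(1 <= j < r) phat beta r j * ln (phat beta r j).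

(* The integrals over [0, 1] are Lebesgue integrals over the open interval,
   where all powers and logarithms have a positive argument (the library's
   values of [powR] and [ln] at 0 are conventions).  The integrands are
   integrable exactly when [-1 < beta]; otherwise the values are junk. *)
Definition c_ (R : realType) (beta : R) : R :=
  \int[lebesgue_measure]_(s in `]0, 1[) (s `^ beta * (1 - s) `^ beta).

Definition d_ (R : realType) (beta : R) : R :=
  \int[lebesgue_measure]_(s in `]0, 1[) (s `^ beta * (1 - s) `^ beta * ln s).

(* Main.v *)
Require Import Defs.
From mathcomp Require Import all_boot all_order all_algebra.
From mathcomp Require Import all_classical all_reals all_analysis.
From mathcomp Require Import measurable_realfun zify ring lra.

Import Order.TTheory GRing.Theory Num.Theory.
Import numFieldNormedType.Exports.

Local Open Scope classical_set_scope.
Local Open Scope ring_scope.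

(** Put [wt s = s (1 - s)] and [A_b r = r^-1 * \sum_(0 < j < r) wt (j / r) ^ b].
    Since [lambda_j = r^2 wt (j / r)], the factors [r^2] cancel in [phat] and
    the normalising sum is [r * A_b r], whence ([entropy_subln])
    [[
      entropy b r - ln r = ln (A_b r) - b * L_b r / A_b r,
    ]]
    where [L_b] is the Riemann sum of [wt ^ b * ln wt]. The grid is symmetric
    under [s -> 1 - s], so [L_b] is twice the Riemann sum of [wt ^ b * ln s].

    For [-1 < b] the Riemann sums converge to [c_ b] and [d_ b]. The integrands
    may be unbounded near 0 and 1, so convergence comes from dominated convergence
    ([cvg_riemann_sum]): the sum is the integral of a step function, and every
    function that is bounded by a multiple of [wt ^ a] with [-1 < a <= 0] has
    step functions bounded by a fixed multiple of [wt ^ a], which is integrable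
    ([integrable_powR_wt]). A logarithm costs only an arbitrarily small power.

    For [b <= -1] the sum [A_b r] dominates a harmonic sum and tends to infinity.
    The function [b |-> ln (A_b r)] is convex with derivative [L_b r / A_b r];
    so it lies above its tangent at [b] ([ln_riemann_sum_tangent]). Evaluating
    that tangent at [-1/2] bounds the derivative from above and gives
    ([entropy_subln_le])
    [[
      entropy b r - ln r <=
        (- ln (A_b r) / 2 - b * ln (A_(-1/2) r)) / (- 1/2 - b),
    ]]
    where the denominator is positive, [A_(-1/2) r] converges by the first case,
    and [ln (A_b r)] tends to infinity. *)

(** * Sums over the grid of the fractions [j / r] *)

Definition wt {R : realType} (s : R) : R := s * (1 - s).

(** The endpoints 0 and 1 are left out, because the functions of interest may be
    singular there. *)
Definition riemann_sum {R : realType} (g : R -> R) (r : nat) : R :=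
  r%:R^-1 * \sum_(1 <= j < r) g (j%:R / r%:R).

Section grid.
Context {R : realType}.
Implicit Types (g h : R -> R) (r j : nat) (s x y a b : R).

Lemma wt_gt0 s : 0 < s -> s < 1 -> 0 < wt s.
Proof. by move=> s0 s1; rewrite /wt mulr_gt0// subr_gt0. Qed.

Lemma wt_le1 s : 0 < s -> s < 1 -> wt s <= 1.
Proof. by move=> s0 s1; rewrite /wt; nra. Qed.

Lemma grid_gt0 r j : (0 < j < r)%N -> 0 < j%:R / r%:R :> R.
Proof.
by case/andP=> j0 jr; rewrite divr_gt0// ltr0n// (leq_trans j0 (ltnW jr)).
Qed.

Lemma grid_lt1 r j : (0 < j < r)%N -> j%:R / r%:R < 1 :> R.
Proof.
case/andP=> j0 jr; rewrite ltr_pdivrMr ?mul1r ?ltr_nat//.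
by rewrite ltr0n (leq_trans j0 (ltnW jr)).
Qed.

Lemma wt_grid_gt0 r j : (0 < j < r)%N -> 0 < wt (j%:R / r%:R : R).
Proof. by move=> jr; rewrite wt_gt0 ?grid_gt0 ?grid_lt1. Qed.

Lemma eq_riemann_sum g h r : (forall s, 0 < s -> s < 1 -> g s = h s) ->
  riemann_sum g r = riemann_sum h r.
Proof.
move=> gh; rewrite /riemann_sum; congr (_ * _); apply: eq_big_nat => j jr.
by rewrite gh ?grid_gt0 ?grid_lt1.
Qed.

Lemma le_riemann_sum g h r : (forall s, 0 < s -> s < 1 -> g s <= h s) ->
  riemann_sum g r <= riemann_sum h r.
Proof.
move=> gh; rewrite /riemann_sum ler_wpM2l ?invr_ge0//.
apply: ler_sum_nat => j jr.
by rewrite gh ?grid_gt0 ?grid_lt1.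
Qed.

Lemma riemann_sum_gt0 g r : (1 < r)%N ->
  (forall s, 0 < s -> s < 1 -> 0 < g s) -> 0 < riemann_sum g r.
Proof.
move=> r1 g0; rewrite /riemann_sum mulr_gt0 ?invr_gt0 ?ltr0n//.
  exact: ltnW.
rewrite big_ltn//= ltr_wpDr//; last by rewrite g0// ?grid_gt0 ?grid_lt1.
rewrite big_nat_cond sumr_ge0// => j /andP[/andP[j1 jr] _].
have jr' : (0 < j < r)%N by rewrite jr (ltn_trans _ j1).
by rewrite ltW// g0// ?grid_gt0 ?grid_lt1.
Qed.

Lemma riemann_sumD g h r :
  riemann_sum (fun s => g s + h s) r = riemann_sum g r + riemann_sum h r.
Proof. by rewrite /riemann_sum big_split mulrDr. Qed.

Lemma riemann_sumZ a g r :
  riemann_sum (fun s => a * g s) r = a * riemann_sum g r.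
Proof. by rewrite /riemann_sum -mulr_sumr mulrCA. Qed.

Lemma riemann_sum_rev g r :
  riemann_sum (fun s => g (1 - s)) r = riemann_sum g r.
Proof.
rewrite /riemann_sum; congr (_ * _); rewrite [RHS]big_nat_rev/=.
apply: eq_big_nat => j /andP[j0 jr]; congr g.
have r0 : r%:R != 0 :> R by rewrite pnatr_eq0 -lt0n (leq_trans j0 (ltnW jr)).
by rewrite addSn add0n subSS natrB ?(ltnW jr)// mulrBl divff.
Qed.

(** Both halves of [ln (wt s) = ln s + ln (1 - s)] have the same Riemann sum,
    because [wt] is invariant under [s -> 1 - s]. *)
Lemma riemann_sum_ln_wt b r :
  riemann_sum (fun s => wt s `^ b * ln (wt s)) r =
  2 * riemann_sum (fun s => wt s `^ b * ln s) r.
Proof.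
transitivity (riemann_sum (fun s => wt s `^ b * ln s) r +
    riemann_sum (fun s => wt (1 - s) `^ b * ln (1 - s)) r).
  rewrite -riemann_sumD; apply: eq_riemann_sum => s s0 s1.
  have -> : wt (1 - s) = wt s by rewrite /wt; ring.
  by rewrite -mulrDr {2}/wt lnM// posrE// subr_gt0.
by rewrite (riemann_sum_rev (fun s => wt s `^ b * ln s)) mulr_natl mulr2n.
Qed.

Lemma lambda_grid r j : (0 < r)%N ->
  lambda R r j = r%:R ^+ 2 * wt (j%:R / r%:R).
Proof.
move=> r0; rewrite /lambda /wt; field.
by rewrite pnatr_eq0 -lt0n.
Qed.

Lemma phat_grid b r j : (0 < j < r)%N ->
  phat b r j =
    wt (j%:R / r%:R) `^ b / (r%:R * riemann_sum (fun s => wt s `^ b) r).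
Proof.
move=> jr; have r0 : (0 < r)%N by case/andP: jr => j0 /ltnW; exact: leq_trans.
rewrite /phat; under eq_big_nat => k kr.
  rewrite lambda_grid// powRM ?exprn_ge0//; last exact/ltW/wt_grid_gt0.
  over.
rewrite -mulr_sumr lambda_grid// powRM ?exprn_ge0//; last exact/ltW/wt_grid_gt0.
rewrite /riemann_sum mulrA divff ?mul1r ?pnatr_eq0 -?lt0n//.
rewrite invfM mulrACA divff ?mul1r//.
by rewrite gt_eqF// powR_gt0// exprn_gt0// ltr0n.
Qed.

(** * The entropy in terms of Riemann sums *)

(** In [- \sum p ln p] the logarithm of [p = wt ^ b / (r A)] splits as
    [b ln wt - ln r - ln A], and the [p]'s sum to 1. *)
Lemma entropy_subln b r : (1 < r)%N ->
  entropy b r - ln r%:R = ln (riemann_sum (fun s => wt s `^ b) r) -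
    b * (riemann_sum (fun s => wt s `^ b * ln (wt s)) r /
         riemann_sum (fun s => wt s `^ b) r).
Proof.
move=> r1; set A := riemann_sum _ _.
have A0 : 0 < A.
  by apply: riemann_sum_gt0 => // s s0 s1; rewrite powR_gt0 ?wt_gt0.
have r0 : 0 < r%:R :> R by rewrite ltr0n (ltn_trans _ r1).
have Z0 : 0 < r%:R * A by rewrite mulr_gt0.
have phatE j : (0 < j < r)%N -> phat b r j * ln (phat b r j) =
    (r%:R * A)^-1 * (b * (wt (j%:R / r%:R) `^ b * ln (wt (j%:R / r%:R))) +
                     - ln (r%:R * A) * wt (j%:R / r%:R) `^ b).
  move=> jr; rewrite phat_grid// -/A ln_div ?posrE ?powR_gt0 ?wt_grid_gt0//.
  by rewrite ln_powR; ring.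
rewrite /entropy (eq_big_nat _ _ phatE).
rewrite -mulr_sumr big_split/= -!mulr_sumr lnM ?posrE//.
rewrite /A /riemann_sum in A0 *.
set S := \sum_(_ <= _ < _) _; set T := \sum_(_ <= _ < _) _ in A0 *.
field.
have T0 : T != 0 by apply: contraTneq A0 => ->; rewrite mulr0 ltxx.
by rewrite T0 gt_eqF.
Qed.

(** Convexity of [b |-> ln (\sum wt ^ b)], as Jensen's inequality for the
    probability [p] proportional to [wt ^ b]: the mean of [ln (wt ^ (a - b))] is
    at most the logarithm of the mean of [wt ^ (a - b)]. It follows by averaging
    [ln x <= x - 1] at [x = wt ^ (a - b) / (B / A)], where [B / A] is that
    mean. *)
Lemma ln_riemann_sum_tangent a b r : (1 < r)%N ->
  ln (riemann_sum (fun s => wt s `^ b) r) +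
    (a - b) * (riemann_sum (fun s => wt s `^ b * ln (wt s)) r /
               riemann_sum (fun s => wt s `^ b) r)
  <= ln (riemann_sum (fun s => wt s `^ a) r).
Proof.
move=> r1; set A := riemann_sum (fun s => wt s `^ b) r.
set L := riemann_sum _ r; set B := riemann_sum _ r.
have A0 : 0 < A.
  by apply: riemann_sum_gt0 => // s s0 s1; rewrite powR_gt0 ?wt_gt0.
have B0 : 0 < B.
  by apply: riemann_sum_gt0 => // s s0 s1; rewrite powR_gt0 ?wt_gt0.
have : riemann_sum (fun s => (a - b) * (wt s `^ b * ln (wt s)) +
      (ln A - ln B) * wt s `^ b) r <=
    riemann_sum (fun s => (A / B) * wt s `^ a + - 1 * wt s `^ b) r.
  apply: le_riemann_sum => s s0 s1; have w0 := wt_gt0 _ s0 s1.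
  have p0 : 0 < wt s `^ (a - b) by rewrite powR_gt0.
  have wab : wt s `^ a = wt s `^ (a - b) * wt s `^ b.
    by rewrite -powRD ?subrK ?(gt_eqF w0) ?implybT.
  (* [ln x <= x - 1], to be multiplied by [wt s `^ b] *)
  have H : (a - b) * ln (wt s) + (ln A - ln B) <=
      wt s `^ (a - b) * (A / B) - 1.
    rewrite -ln_powR -ln_div ?posrE// -lnM ?posrE ?divr_gt0//.
    rewrite -[X in ln X](subrK 1) addrC le_ln1Dx// ltrBrDl subrr.
    by rewrite mulr_gt0// divr_gt0.
  rewrite wab; have := ler_wpM2r (powR_ge0 (wt s) b) H; nra.
rewrite !riemann_sumD !riemann_sumZ -/A -/B -/L divfK ?gt_eqF//.
rewrite mulN1r subrr => H.
rewrite -lerBrDl -subr_ge0 -(pmulr_lge0 _ A0).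
rewrite (_ : _ * A = - ((a - b) * L + (ln A - ln B) * A)).
  by rewrite oppr_ge0.
by field; rewrite gt_eqF.
Qed.

End grid.

(** * Integrability of powers of [s (1 - s)] *)

Section weight_power.
Context {R : realType}.
Implicit Types (s x y a b : R).
Local Notation mu := (@lebesgue_measure R).

(** Nonpositive powers decrease, so a point at least half as large has a power at
    most [2 ^ (- a) <= 2] times as large. *)
Lemma powR_le2 a x y : -1 <= a -> a <= 0 -> 0 < x -> x / 2 <= y ->
  y `^ a <= 2 * x `^ a.
Proof.
move=> a1 a0 x0 xy; have y0 : 0 < y by rewrite (lt_le_trans _ xy)// divr_gt0.
rewrite -[a]opprK; have : - a <= 1 by rewrite lerNl.
have : 0 <= - a by rewrite oppr_ge0.
move: (- a) => b b0 b1; rewrite !powRN.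
rewrite -lef_pV2 ?posrE ?mulr_gt0 ?invr_gt0 ?powR_gt0// invfM !invrK.
rewrite (@le_trans _ _ ((x / 2) `^ b))//.
  rewrite powRM ?(ltW x0)// mulrC ler_wpM2l ?powR_ge0// ger1_powR//; lra.
by rewrite ge0_ler_powR ?nnegrE// ?divr_ge0// ltW.
Qed.

Lemma continuous_powR a x : 0 < x -> {for x, continuous (fun y => y `^ a)}.
Proof.
move=> x0; apply/differentiable_continuous/derivable1_diffP.
by apply: derivable_powR; rewrite in_itv/= x0.
Qed.

Lemma measurable_powR_onem a : measurable_fun [set: R] (fun s => (1 - s) `^ a).
Proof.
apply: (measurableT_comp (measurable_powR a)).
exact: measurable_funB.
Qed.

Let F a s : R := (s `^ (a + 1) - (1 - s) `^ (a + 1)) / (a + 1).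

Let is_derive_F a s : -1 < a -> 0 < s -> s < 1 ->
  is_derive s 1 (F a) (s `^ a + (1 - s) `^ a).
Proof.
move=> a1 s0 s1; have a10 : a + 1 != 0 by rewrite gt_eqF//; lra.
have d1 := is_derive1_powR (a + 1) s0.
have s10 : 0 < 1 - s by rewrite subr_gt0.
have d2 := is_derive1_powR (a + 1) s10.
have d3 : is_derive s 1 (fun t : R => 1 - t) (-1).
  by apply: is_derive_eq; rewrite add0r mul1r.
have d4 := @is_derive1_comp _ (fun t => t `^ (a + 1)) (fun t : R => 1 - t)
  s _ _ d2 d3.
rewrite (_ : F a = (a + 1)^-1 *: (@powR R ^~ (a + 1) -
    (@powR R ^~ (a + 1) \o (fun t : R => 1 - t)))); last first.
  by apply/funext => t; rewrite /F /= mulrC.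
apply: is_derive_eq; rewrite addrK /GRing.scale/=; field.
by [].
Qed.

(** Monotone convergence along compact intervals exhausting the open one, on each
    of which the primitive [F] gives a value at most [2 / (a + 1)]. *)
Lemma integrable_powR_sum a : -1 < a ->
  mu.-integrable `]0, 1[ (EFin \o (fun s => s `^ a + (1 - s) `^ a)).
Proof.
move=> a1; set h := fun s => _.
have a10 : 0 < a + 1 by lra.
have h0 s : 0 <= h s by rewrite addr_ge0 ?powR_ge0.
have mh D : measurable_fun D (EFin \o h).
  apply/measurable_EFinP; apply: (@measurable_funS _ _ _ _ setT) => //.
  apply: measurable_funD; first exact: measurable_powR.
  exact: measurable_powR_onem.
apply/integrableP; split; first exact: mh.
under eq_integral do rewrite gee0_abs ?lee_fin//.
(* [n.+3] makes the interval nondegenerate for every [n] *)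
pose D n : set R := `[n.+3%:R^-1, 1 - n.+3%:R^-1]%classic.
have D01 : \bigcup_n D n = `]0, 1[%classic.
  apply/seteqP; split => s /=.
    move=> [n _]; rewrite /D /= !in_itv/= => /andP[ns sn].
    have n30 : 0 < n.+3%:R^-1 :> R by rewrite invr_gt0.
    by move: n.+3%:R^-1 ns sn n30 => t *; apply/andP; split; lra.
  rewrite in_itv/= => /andP[s0 s1].
  have m0 : 0 < Num.min s (1 - s) by rewrite lt_min s0 subr_gt0.
  have [N _ /(_ N (leqnn _))/=] := near_infty_natSinv_lt (PosNum m0).
  rewrite lt_min => /andP[Ns N1s]; exists N => //; rewrite /D/= in_itv/=.
  have N3 : N.+3%:R^-1 <= N.+1%:R^-1 :> R.
    by rewrite lef_pV2 ?posrE// ler_nat leqW// leqW.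
  rewrite (le_trans N3 (ltW Ns))/= lerBrDl -lerBrDr.
  exact: (le_trans N3 (ltW N1s)).
have ndD : nondecreasing_seq D.
  move=> m n mn; rewrite subsetEset /D => s /=.
  rewrite !in_itv/= => /andP[ms sm].
  have nm : n.+3%:R^-1 <= m.+3%:R^-1 :> R by rewrite lef_pV2 ?posrE// ler_nat.
  by rewrite (le_trans nm)//= (le_trans sm)// lerB.
have cvD : (\int[mu]_(s in D n) (h s)%:E @[n --> \oo] -->
    \int[mu]_(s in \bigcup_n D n) (h s)%:E)%E.
  apply: ge0_nondecreasing_set_cvg_integral => //.
  - by move=> n; exact: measurable_itv.
  - by move=> n; exact: mh.
  - by move=> n s _; rewrite lee_fin; exact: h0.
rewrite D01 in cvD.
apply: (@le_lt_trans _ _ (2 / (a + 1))%:E); last exact: ltry.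
apply: cvge_to_le cvD _; apply: nearW => n; rewrite /D.
have n30 : 0 < n.+3%:R^-1 :> R by rewrite invr_gt0.
have n31 : n.+3%:R^-1 < 1 - n.+3%:R^-1 :> R.
  have : n.+3%:R^-1 <= 3^-1 :> R by rewrite lef_pV2 ?posrE// ler_nat.
  by move: n.+3%:R^-1 => t; lra.
have inD s : s \in `[n.+3%:R^-1, 1 - n.+3%:R^-1] -> is_derive s 1 (F a) (h s).
  rewrite in_itv/= => /andP[ns sn]; apply: is_derive_F => //.
    exact: lt_le_trans ns.
  by rewrite (le_lt_trans sn)// ltrBlDr ltrDl.
have cF : {within `[n.+3%:R^-1, 1 - n.+3%:R^-1], continuous (F a)}.
  by apply: derivable_within_continuous => s /inD[].
rewrite (@continuous_FTC2 _ h (F a))//.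
- rewrite -EFinB lee_fin /F -mulrBl ler_wpM2r ?invr_ge0 ?(ltW a10)//.
  set t := n.+3%:R^-1.
  have p1 s : 0 <= s -> s <= 1 -> s `^ (a + 1) <= 1.
    move=> s0 s1; have : s `^ (a + 1) <= 1 `^ (a + 1).
      by rewrite ge0_ler_powR ?nnegrE// ltW.
    by rewrite powR1.
  have t1 : t < 1 by rewrite invf_lt1// ltr1n.
  have := p1 (1 - t); have := powR_ge0 t (a + 1).
  rewrite (_ : 1 - (1 - t) = t); last by ring.
  rewrite subr_ge0 (ltW t1) lerBlDl lerDr (ltW n30).
  move=> + /(_ isT isT); lra.
- apply/continuous_in_subspaceT => s; rewrite inE/= in_itv/= => /andP[ns sn].
  have s0 : 0 < s by exact: lt_le_trans ns.
  have s1 : 0 < 1 - s by rewrite subr_gt0 (le_lt_trans sn)// ltrBlDr ltrDl.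
  apply: cvgD; first exact: continuous_powR.
  have := @continuous_comp R R R (fun t => 1 - t) (fun t => t `^ a) s.
  apply; last exact: continuous_powR.
  by apply: cvgB; [exact: cvg_cst|exact: cvg_id].
- have [? ? ?] := (continuous_within_itvP _ n31).1 cF; split => //.
  by move=> s /subset_itv_oo_cc/inD[].
- by move=> s /subset_itv_oo_cc/inD/@derive_val; rewrite derive1E.
Qed.

(** Powers of [wt] have no elementary primitive in general, unlike this majorant.
    One of the two factors of [wt s] is always at least [1/2]. *)
Lemma powR_wt_le a s : -1 <= a -> a <= 0 -> 0 < s -> s < 1 ->
  wt s `^ a <= 2 * (s `^ a + (1 - s) `^ a).
Proof.
move=> a1 a0 s0 s1; have := powR_ge0 s a; have := powR_ge0 (1 - s) a.
have [sh|sh] := leP s 2^-1.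
  have : wt s `^ a <= 2 * s `^ a by apply: powR_le2 => //; rewrite /wt; nra.
  lra.
have : wt s `^ a <= 2 * (1 - s) `^ a.
  by apply: powR_le2 => //; rewrite /wt; nra.
lra.
Qed.

Lemma measurable_wt D : measurable_fun D (@wt R).
Proof.
apply: (@measurable_funS _ _ _ _ setT) => //.
by apply: measurable_funM => //; exact: measurable_funB.
Qed.

Lemma measurable_powR_wt a D : measurable_fun D (fun s : R => wt s `^ a).
Proof. exact: (measurableT_comp (measurable_powR a) (measurable_wt _)). Qed.

Lemma integrable_powR_wt a : -1 < a -> a <= 0 ->
  mu.-integrable `]0, 1[ (EFin \o (fun s => wt s `^ a)).
Proof.
move=> a1 a0.
have : mu.-integrable `]0, 1[ (fun s => 2%:E * (s `^ a + (1 - s) `^ a)%:E)%E.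
  by apply: integrableZl => //; exact: integrable_powR_sum.
apply: le_integrable => //.
  by apply/measurable_EFinP; exact: measurable_powR_wt.
move=> s /=; rewrite in_itv/= => /andP[s0 s1]; rewrite lee_fin.
rewrite !ger0_norm ?powR_ge0 ?mulr_ge0 ?addr_ge0 ?powR_ge0//.
exact: powR_wt_le (ltW a1) a0 s0 s1.
Qed.

End weight_power.

(** * Riemann sums of functions with integrable singularities at 0 and 1 *)

Section riemann_sum_cvg.
Context {R : realType}.
Implicit Types (g : R -> R) (r j : nat) (s a K : R).
Local Notation mu := (@lebesgue_measure R).

Let cell r j : set R := `](j.-1%:R / r%:R), (j%:R / r%:R)]%classic.

(** On the interval from 0 to 1 its integral is [riemann_sum g r]; the cell that
    ends at 1 gets the value 0. *)
Let step g r s : R := \sum_(1 <= j < r) g (j%:R / r%:R) * \1_(cell r j) s.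

Let step_in g r j s : (0 < j < r)%N -> cell r j s ->
  step g r s = g (j%:R / r%:R).
Proof.
move=> /andP[j0 jr]; rewrite /cell/= in_itv/= => /andP[js sj].
have r0 : 0 < r%:R^-1 :> R by rewrite invr_gt0 ltr0n (leq_trans j0 (ltnW jr)).
rewrite /step (bigD1_seq j)/=; last 2 first.
- by rewrite mem_index_iota j0.
- exact: iota_uniq.
rewrite indicE mem_set ?mulr1/=; last by rewrite /cell/= in_itv/= js.
rewrite big1_seq ?addr0// => i /andP[ij _].
rewrite indicE memNset ?mulr0// /cell/= in_itv/= => /andP[is_ si].
have : (j.-1 < i)%N by rewrite -(ltr_nat R) -(ltr_pM2r r0) (lt_le_trans js).
have : (i.-1 < j)%N by rewrite -(ltr_nat R) -(ltr_pM2r r0) (lt_le_trans is_).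
case: i ij {is_ si} => [|i] ij /=; rewrite ?ltn0//.
by case: j j0 jr js sj ij => [|j]//= *; lia.
Qed.

Let step_out g r s : r.-1%:R / r%:R < s -> step g r s = 0.
Proof.
move=> rs; rewrite /step big1_seq// => j /andP[_].
rewrite mem_index_iota => /andP[j0 jr].
have r0 : 0 < r%:R^-1 :> R by rewrite invr_gt0 ltr0n (leq_trans j0 (ltnW jr)).
rewrite indicE memNset ?mulr0// /cell/= in_itv/= => /andP[_ sj].
have : (r.-1 < j)%N by rewrite -(ltr_nat R) -(ltr_pM2r r0) (lt_le_trans rs).
by case: r {rs r0 sj} jr => // r /=; lia.
Qed.

Let cell_ex r s : (0 < r)%N -> 0 < s -> s < 1 ->
  exists2 j, (0 < j <= r)%N & cell r j s.
Proof.
move=> r0 s0 s1; have rr0 : 0 < r%:R :> R by rewrite ltr0n.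
have ex : exists j, s * r%:R <= j%:R by exists r; rewrite ger_pMl// ltW.
case: (ex_minnP ex) => j sj jmin; exists j.
  apply/andP; split; last by apply: jmin; rewrite ger_pMl// ltW.
  by rewrite lt0n; apply: contraTneq sj => ->; rewrite -ltNge mulr_gt0.
rewrite /cell/= in_itv/= ltr_pdivrMr// ler_pdivlMr// sj andbT.
rewrite ltNge; apply/negP => /jmin; case: j sj {jmin} => [|j] /=; last by lia.
by rewrite leNgt mulr_gt0.
Qed.

(** Moving from [s] to the right end [x] of its cell increases the first factor
    of [wt]. It at most halves the second one: [x - s < r^-1 <= 1 - x], since the
    last cell is excluded. *)
Let cell_wt r j s : (0 < j < r)%N -> 0 < s -> cell r j s ->
  wt s / 2 <= wt (j%:R / r%:R).
Proof.
move=> jr s0; have := @grid_lt1 R r j jr; case/andP: jr => j0 jr.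
have rr0 : 0 < r%:R^-1 :> R by rewrite invr_gt0 ltr0n (leq_trans j0 (ltnW jr)).
have : (j%:R + 1) / r%:R <= 1 :> R.
  rewrite ler_pdivrMr ?mul1r ?natr1 ?ler_nat//.
  by rewrite ltr0n (leq_trans j0 (ltnW jr)).
rewrite /cell/= in_itv/= -subn1 natrB// mulrBl mulrDl mul1r.
move: (j%:R / r%:R : R) (r%:R^-1 : R) rr0 => x t t0 xt x1 /andP[xs sx].
rewrite /wt; nra.
Qed.

Let measurable_step g r D : measurable_fun D (step g r).
Proof.
apply: measurable_sum => j; apply: measurable_funM => //.
by apply: measurable_indic; exact: measurable_itv.
Qed.

Let integral_step g r :
  (\int[mu]_(s in `]0%R, 1%R[) (step g r s)%:E = (riemann_sum g r)%:E)%E.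
Proof.
have mcell j : measurable (cell r j) by exact: measurable_itv.
have icell j : mu.-integrable `]0, 1[ (fun s => (\1_(cell r j) s)%:E).
  by apply: (@integrableS _ _ _ mu setT) => //; exact: integrable_indic_itv.
transitivity (\int[mu]_(s in `]0%R, 1%R[) \sum_(1 <= j < r)
    ((g (j%:R / r%:R))%:E * (\1_(cell r j) s)%:E))%E.
  by apply: eq_integral => s _; rewrite /step -sumEFin; apply: eq_bigr.
rewrite integral_sum//; last by move=> j; exact: integrableZl.
rewrite /riemann_sum mulr_sumr -sumEFin; apply: eq_big_nat => j jr.
rewrite integralZl// integral_indic//; last exact: mcell.
rewrite (_ : _ `&` _ = cell r j); last first.
  apply/setIidPl => s; rewrite /cell/= !in_itv/= => /andP[js sj].
  by rewrite (le_lt_trans sj (grid_lt1 _ _ jr)) (le_lt_trans _ js)// divr_ge0.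
have r0 : 0 < r%:R^-1 :> R.
  by rewrite invr_gt0 ltr0n; case/andP: jr => j0 /ltnW; exact: leq_trans.
have mucell : lebesgue_measure (cell r j) = (r%:R^-1)%:E.
  rewrite /cell lebesgue_measure_itv/= lte_fin ltr_pM2r// ltr_nat.
  case/andP: jr; case: j => // j _ _; rewrite ltnSn -EFinD -mulrBl -natrB//.
  by rewrite subSnn mul1r.
by rewrite [X in (_ * X)%E]mucell -EFinM mulrC.
Qed.

(** Dominated convergence for the step functions. The bound on [g] passes to the
    step functions with constant [2 * K] by [cell_wt] and [powR_le2]; continuity
    gives pointwise convergence, since any [s < 1] eventually leaves the last
    cell. *)
Lemma cvg_riemann_sum g a K : -1 < a -> a <= 0 ->
  {in `]0, 1[, continuous g} ->
  (forall s, 0 < s -> s < 1 -> `|g s| <= K * wt s `^ a) ->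
  riemann_sum g r @[r --> \oo] --> (\int[mu]_(s in `]0, 1[) g s)%R.
Proof.
move=> a1 a0 cg gK.
have mg : measurable_fun (`]0, 1[%classic : set R) g.
  by apply: open_continuous_measurable_fun => // s; rewrite inE; exact: cg.
have dom s r : 0 < s -> s < 1 -> `|step g r s| <= 2 * K * wt s `^ a.
  move=> s0 s1.
  have K0 : 0 <= K * wt s `^ a := le_trans (normr_ge0 _) (gK s s0 s1).
  have K00 : 0 <= K by rewrite -(pmulr_lge0 _ (powR_gt0 a (wt_gt0 s s0 s1))).
  have [->|r0] := posnP r.
    by rewrite /step big_geq// normr0 -mulrA mulr_ge0.
  have [j /andP[j0]] := cell_ex r s r0 s0 s1.
  rewrite leq_eqVlt => /predU1P[->|jr] sj.
    rewrite step_out ?normr0 ?mulr_ge0 ?powR_ge0//.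
    by move: sj; rewrite /cell/= in_itv/= => /andP[].
  have jr' : (0 < j < r)%N by rewrite j0.
  rewrite (step_in _ _ _ _ jr' sj).
  rewrite (le_trans (gK _ (grid_gt0 _ _ jr') (grid_lt1 _ _ jr')))//.
  rewrite (mulrC 2) -mulrA ler_wpM2l//.
  by apply: powR_le2; [exact: ltW|by []|exact: wt_gt0|exact: cell_wt].
have lim s : 0 < s -> s < 1 -> step g r s @[r --> \oo] --> g s.
  move=> s0 s1; apply/cvgrPdist_lt => e e0.
  have sI : s \in `]0, 1[ by rewrite in_itv/= s0.
  have /cvgrPdist_lt/(_ e e0)/nbhs_ballP[d /= d0 gd] := cg s sI.
  have m0 : 0 < Num.min d (1 - s) by rewrite lt_min d0 subr_gt0.
  near=> r.
  have r0 : (0 < r)%N by near: r; exact: nbhs_infty_gt.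
  have : r%:R^-1 < Num.min d (1 - s).
    rewrite invf_plt ?posrE ?ltr0n//; near: r; exact: nbhs_infty_gtr.
  rewrite lt_min => /andP[rd rs].
  have [j /andP[j0]] := cell_ex r s r0 s0 s1.
  have rV : r%:R / r%:R = 1 :> R by rewrite divff// pnatr_eq0 -lt0n.
  have pred_div i : (0 < i)%N -> i.-1%:R / r%:R = i%:R / r%:R - r%:R^-1 :> R.
    by move=> i0; rewrite -subn1 natrB// mulrBl mul1r.
  rewrite leq_eqVlt => /predU1P[->|jr] sj.
    move: sj; rewrite /cell/= in_itv/= pred_div// rV => /andP[H _].
    (* [s] in the last cell contradicts [r^-1 < 1 - s] *)
    by exfalso; move: r%:R^-1 rs H => t *; lra.
  have jr' : (0 < j < r)%N by rewrite j0.
  rewrite (step_in _ _ _ _ jr' sj); apply: gd.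
  move: sj; rewrite /cell/= in_itv/= pred_div// /ball/= => /andP[sj js].
  rewrite ler0_norm ?subr_le0//.
  by move: (j%:R / r%:R : R) (r%:R^-1 : R) rd sj js => *; lra.
have [] := @dominated_convergence _ _ R mu `]0, 1[ (measurable_itv _)
   (fun r s => (step g r s)%:E) (fun s => (g s)%:E)
   (fun s => (2 * K * wt s `^ a)%:E).
- by move=> r; apply/measurable_EFinP; exact: measurable_step.
- exact/measurable_EFinP.
- apply: aeW => s /=; rewrite in_itv/= => /andP[s0 s1].
  by apply: cvg_EFin; [exact: nearW|exact: lim].
- suff : mu.-integrable `]0, 1[ (fun s => (2 * K)%:E * (wt s `^ a)%:E)%E.
    by apply: eq_integrable.
  by apply: integrableZl => //; exact: integrable_powR_wt.
- apply: aeW => s r /=; rewrite in_itv/= => /andP[s0 s1].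
  by rewrite lee_fin dom.
move=> ig _; rewrite /=; under eq_cvg do rewrite integral_step.
have fin : (\int[mu]_(s in `]0%R, 1%R[) (g s)%:E)%E \is a fin_num.
  exact: integrable_fin_num ig.
by rewrite -(fineK fin) => /fine_cvgP[].
Unshelve. all: by end_near. Qed.

End riemann_sum_cvg.

(** * The integrals [c_] and [d_] as limits *)

Section integrals.
Context {R : realType}.
Implicit Types (s a b : R) (r : nat).
Local Notation mu := (@lebesgue_measure R).

Lemma continuous_powR_wt b : {in `]0, 1[, continuous (fun s : R => wt s `^ b)}.
Proof.
move=> s; rewrite in_itv/= => /andP[s0 s1].
have := @continuous_comp R R R (@wt R) (fun t => t `^ b) s.
apply; last exact/continuous_powR/wt_gt0.
apply: cvgM; first exact: cvg_id.
by apply: cvgB; [exact: cvg_cst|exact: cvg_id].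
Qed.

(** The gap between this exponent and [b] pays for a factor [ln s]. *)
Let expo b : R := (Num.min b 0 - 1) / 2.

Let expoP b : -1 < b -> [/\ -1 < expo b, expo b <= 0 & expo b < b].
Proof. by move=> b1; rewrite /expo; have [b0|b0] := leP b 0; split; lra. Qed.

Lemma c_wtE b : c_ b = \int[mu]_(s in `]0, 1[) (wt s `^ b).
Proof.
apply: eq_Rintegral => s; rewrite inE/= in_itv/= => /andP[s0 s1].
by rewrite powRM ?subr_ge0// ltW.
Qed.

Lemma d_wtE b : d_ b = \int[mu]_(s in `]0, 1[) (wt s `^ b * ln s).
Proof.
apply: eq_Rintegral => s; rewrite inE/= in_itv/= => /andP[s0 s1].
by rewrite powRM ?subr_ge0// ltW.
Qed.

Lemma cvg_riemann_sum_powR_wt b : -1 < b ->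
  riemann_sum (fun s => wt s `^ b) r @[r --> \oo] --> c_ b.
Proof.
move=> b1; have [e1 e0 eb] := expoP _ b1.
rewrite c_wtE; apply: (@cvg_riemann_sum _ _ (expo b) 1) => //.
  exact: continuous_powR_wt.
move=> s s0 s1; rewrite mul1r ger0_norm ?powR_ge0//.
by apply: ger_powR; [rewrite wt_gt0// wt_le1|exact: ltW].
Qed.

(** With [e = b - expo b > 0], one has [- ln s <= - ln (wt s) <= e^-1 wt s ^ (- e)]
    because [ln x < x]; so the integrand is at most [e^-1 wt ^ expo b]. *)
Lemma cvg_riemann_sum_powR_wt_ln b : -1 < b ->
  riemann_sum (fun s => wt s `^ b * ln s) r @[r --> \oo] --> d_ b.
Proof.
move=> b1; have [e1 e0 eb] := expoP _ b1.
rewrite d_wtE; apply: (@cvg_riemann_sum _ _ (expo b) (b - expo b)^-1) => //.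
  move=> s sI; apply: cvgM; first exact: continuous_powR_wt.
  by move: sI; rewrite in_itv/= => /andP[s0 s1]; exact: continuous_ln.
move=> s s0 s1; have w0 := wt_gt0 s s0 s1.
have be0 : 0 < b - expo b by rewrite subr_gt0.
rewrite normrM (ger0_norm (powR_ge0 _ _)) (ler0_norm (ln_le0 (ltW s1))).
have lnw : - ln s <= (b - expo b)^-1 * wt s `^ (expo b - b).
  rewrite mulrC ler_pdivlMr// (@le_trans _ _ (ln (wt s `^ (expo b - b))))//.
    have : ln (wt s) <= ln s by rewrite ler_ln ?posrE// /wt; nra.
    by rewrite ln_powR; nra.
  by rewrite ltW// ln_sublinear// powR_gt0.
rewrite (le_trans (ler_wpM2l (powR_ge0 _ _) lnw))// mulrCA -powRD.
  by rewrite subrKC.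
by rewrite (gt_eqF w0) implybT.
Qed.

(** The integrand is positive everywhere on an interval of measure 1, so it cannot
    vanish almost everywhere. Integrability is needed as well: an infinite
    integral has real value 0. *)
Lemma c_gt0 b : -1 < b -> 0 < c_ b.
Proof.
move=> b1; rewrite lt_neqAle; apply/andP; split; last first.
  by apply: Rintegral_ge0 => s _; rewrite mulr_ge0 ?powR_ge0.
apply/eqP => c0.
have m01 : measurable (`]0, 1[%classic : set R) by exact: measurable_itv.
have mw : measurable_fun (`]0, 1[%classic : set R) (fun s => (wt s `^ b)%:E).
  by apply/measurable_EFinP; exact: measurable_powR_wt.
have iw : (\int[mu]_(s in `]0%R, 1%R[) `|(wt s `^ b)%:E| = 0)%E.
  have fin : (\int[mu]_(s in `]0%R, 1%R[) (wt s `^ b)%:E)%E \is a fin_num.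
    apply: integrable_fin_num => //; have [e1 e0 eb] := expoP _ b1.
    apply: le_integrable (integrable_powR_wt _ e1 e0) => //.
    move=> s /=; rewrite in_itv/= lee_fin => /andP[s0 s1].
    rewrite !ger0_norm ?powR_ge0//.
    by apply: ger_powR; [rewrite wt_gt0// wt_le1|exact: ltW].
  transitivity (\int[mu]_(s in `]0%R, 1%R[) (wt s `^ b)%:E)%E.
    by apply: eq_integral => s _; rewrite gee0_abs// lee_fin powR_ge0.
  by rewrite -(fineK fin); move: c0; rewrite c_wtE /Rintegral => <-.
have /(ae_eq_integral_abs mu m01 mw)[N [mN N0 sN]] := iw.
have : (lebesgue_measure (`]0%R, 1%R[%classic : set R) <= lebesgue_measure N)%E.
  apply: le_measure; rewrite ?inE// => s sI; apply: sN => /(_ sI) /=.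
  move: sI; rewrite /= in_itv/= => /andP[s0 s1] -[] /eqP.
  by rewrite gt_eqF// powR_gt0 ?wt_gt0.
rewrite [X in (_ <= X)%E]N0 lebesgue_measure_itv/= lte_fin ltr01.
by rewrite oppr0 addr0 lee_fin ler10.
Qed.

End integrals.

(** * Limit of the entropy *)

Section entropy_limit.
Context {R : realType}.
Implicit Types (b : R) (r : nat).

(** This Riemann sum is a partial sum of the harmonic series. *)
Lemma riemann_sum_inv_dvg (M : R) :
  \forall r \near \oo, M <= riemann_sum (fun s : R => s^-1) r.
Proof.
have nd : nondecreasing_seq (series (@harmonic R)).
  by apply: nondecreasing_series => n _ _; exact: harmonic_ge0.
have [n Mn] : exists n, M < series harmonic n.
  have /cvgryPgt/(_ M)[n _ /(_ n (leqnn n))] :=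
    nondecreasing_dvgn_lt nd (@dvg_harmonic R).
  by exists n.
exists n.+1 => // -[//|r] /= nr.
rewrite (le_trans (ltW Mn))// (le_trans (nd _ _ (nr : (n <= r)%N)))//.
rewrite /riemann_sum /series/= big_add1/= mulr_sumr.
apply: ler_sum_nat => j jr; rewrite invfM invrK mulrCA mulVf ?mulr1//.
Qed.

Lemma riemann_sum_powR_wt_dvg b (M : R) : b <= -1 ->
  \forall r \near \oo, M <= riemann_sum (fun s => wt s `^ b) r.
Proof.
move=> b1; apply: filterS (riemann_sum_inv_dvg M) => r /le_trans; apply.
apply: le_riemann_sum => s s0 s1; have w0 := wt_gt0 s s0 s1.
rewrite (@le_trans _ _ (wt s `^ (-1)))//.
  by rewrite powR_inv1 ?(ltW w0)// lef_pV2 ?posrE// /wt; nra.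
by apply: ger_powR => //; rewrite w0 wt_le1.
Qed.

Lemma cvg_entropy_subln b : -1 < b -> entropy b r - ln r%:R @[r --> \oo] -->
  - (2 * b * d_ b / c_ b) + ln (c_ b).
Proof.
move=> b1; have c0 := c_gt0 _ b1.
have cA := cvg_riemann_sum_powR_wt _ b1.
have cD := cvg_riemann_sum_powR_wt_ln _ b1.
have -> : - (2 * b * d_ b / c_ b) + ln (c_ b) =
    ln (c_ b) - b * (2 * d_ b / c_ b).
  by rewrite addrC; congr (_ - _); ring.
have : ln (riemann_sum (fun s => wt s `^ b) r) -
    b * (2 * riemann_sum (fun s => wt s `^ b * ln s) r /
         riemann_sum (fun s => wt s `^ b) r)
    @[r --> \oo] --> ln (c_ b) - b * (2 * d_ b / c_ b).
  apply: cvgB; first by apply: continuous_cvg => //; exact: continuous_ln.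
  apply: cvgMr; apply: cvgM; first exact: cvgMr.
  by apply: cvgV => //; rewrite gt_eqF.
apply: cvg_trans; apply: near_eq_cvg; near=> r.
have r1 : (1 < r)%N by near: r; exact: nbhs_infty_gt.
by rewrite entropy_subln// riemann_sum_ln_wt.
Unshelve. all: by end_near. Qed.

(** With [A], [B] the sums of exponents [b], [-1/2] and [L] the slope at [b], the
    tangent inequality reads [L <= (ln B - ln A) / (- 1/2 - b)]; as [- b > 0], it
    bounds [ln A - b * L]. Any exponent strictly between [-1] and [0] could replace
    [-1/2]: it has to be negative for [ln A] to get a negative coefficient, and above [-1] for
    [B] to stay bounded. *)
Lemma entropy_subln_le b r : b < - 2^-1 -> (1 < r)%N ->
  entropy b r - ln r%:R <=
  (- (ln (riemann_sum (fun s => wt s `^ b) r) / 2) -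
   b * ln (riemann_sum (fun s => wt s `^ (- 2^-1)) r)) / (- 2^-1 - b).
Proof.
move=> b2 r1; rewrite entropy_subln//.
have := ln_riemann_sum_tangent (- 2^-1) b r r1.
move: (ln _) (ln _) (_ / _) => A B L tg.
have d0 : 0 < - 2^-1 - b by lra.
rewrite ler_pdivlMr//; nra.
Qed.

Lemma entropy_subln_dvg b : b <= -1 ->
  (entropy b r - ln r%:R)%:E @[r --> \oo] --> -oo%E.
Proof.
move=> b1; apply/cvgeNyPle => T.
have h1 : -1 < - 2^-1 :> R by lra.
pose C := ln (c_ (- 2^-1 : R) + 1).
(* [Q] is the value of [ln A] for which the bound of [entropy_subln_le], with
   [C] in place of [ln B], equals [T] *)
pose Q := 2 * (- b * C - (- 2^-1 - b) * T).
near=> r.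
have r1 : (1 < r)%N by near: r; exact: nbhs_infty_gt.
have AQ : expR Q <= riemann_sum (fun s => wt s `^ b) r.
  by near: r; exact: riemann_sum_powR_wt_dvg.
have B0 : 0 < riemann_sum (fun s : R => wt s `^ (- 2^-1)) r.
  by apply: riemann_sum_gt0 => // s s0 s1; rewrite powR_gt0 ?wt_gt0.
have BC : riemann_sum (fun s => wt s `^ (- 2^-1)) r <= c_ (- 2^-1 : R) + 1.
  near: r; have /cvgr_le := cvg_riemann_sum_powR_wt _ h1; apply.
  by rewrite ltrDl.
have lnB : ln (riemann_sum (fun s => wt s `^ (- 2^-1)) r) <= C.
  by rewrite ler_ln ?posrE// (lt_le_trans B0).
have lnA : Q <= ln (riemann_sum (fun s => wt s `^ b) r).
  by rewrite -[Q]expRK ler_ln ?posrE ?expR_gt0// (lt_le_trans _ AQ)// expR_gt0.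
have b2 : b < - 2^-1 by lra.
rewrite lee_fin (le_trans (entropy_subln_le _ _ b2 r1))//.
rewrite ler_pdivrMr; last by lra.
have le_T (A B c : R) : 2 * (- b * c - (- 2^-1 - b) * T) <= A -> B <= c ->
    - (A / 2) - b * B <= T * (- 2^-1 - b) by nra.
exact: le_T lnA lnB.
Unshelve. all: by end_near. Qed.

End entropy_limit.

Theorem theorem2 (R : realType) (beta : R) (beta_neq0 : beta != 0) :
  (entropy beta r - ln r%:R)%:E @[r --> \oo] -->
    (if -1 < beta then (- (2 * beta * d_ beta / c_ beta) + ln (c_ beta))%:E
     else -oo%E).
Proof.
case: ltP => [b1|b1]; last exact: entropy_subln_dvg.
by apply: cvg_EFin; [exact: nearW|exact: cvg_entropy_subln].
Qed.
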